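(* Let $n \ge 1$ and $d \ge 0$ be integers and let $X = (X_1,\ldots,X_n)$. If $p \in \mathbb{R}\langle X, X^*\rangle$, a matrix positive polynomial, is of the form $p = q^* q S$ with $q \in \mathbb{R}\langle X, X^*\rangle$ and $S = \sum_{|\alpha|=d} X^{\alpha^*} X^{\alpha}$, the sum being over all multi-indices $\alpha$ of length $d$, then $\operatorname{rank}(p) \ge (2n)^d$.
   Context: $\mathbb{R}\langle X, X^*\rangle$ is the real free $*$-algebra generated by $n$ noncommuting variables $X_1,\ldots,X_n$ and their adjoints $X_1^*,\ldots,X_n^*$; as an algebra it is the free associative unital $\mathbb{R}$-algebra on these $2n$ generators. The involution $*$ is $\mathbb{R}$-linear, reverses products, and satisfies $(X_j)^* = X_j^*$, $(X_j^* )^* = X_j$. For $0<j\le n$ put $X_{j+n} = X_j^*$. A multi-index $\alpha = (\alpha_1,\ldots,\alpha_k)$ is a finite tuple with entries in $\{1,\ldots,2n\}$, of length $|\alpha| = k$; $X^\alpha = X_{\alpha_1}\cdots X_{\alpha_k}$, and $X^\emptyset = 1$. The multi-index $\alpha^*$ is defined by $X^{\alpha^*} = (X^\alpha)^*$. A polynomial $p$ is symmetric if $p^* = p$. A polynomial $p$ is matrix positive if it is symmetric and $p(M)$ is positive semidefinite (PSD) for every tuple $M = (M_1,\ldots,M_n)$ of real square matrices of the same size (all sizes allowed), where $p(M)$ is obtained by substituting $M_j$ for $X_j$ and $M_j^T$ for $X_j^*$. For an integer $D \ge 0$ let $V_D$ be the column vector $(X^\alpha)_{|\alpha|\le D}$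 (monomials in graded lexicographic order) and $V_D^*$ the row vector $(X^{\alpha^*})_{|\alpha|\le D}$. The rank of a matrix positive polynomial $p$ is the minimum of $\operatorname{rank}(M)$ over all real symmetric PSD matrices $M$ such that $V_D^* M V_D = p$ for some $D$.
   Formalization: The formal theorem additionally assumes that p is not the zero polynomial; for q = 0 the stated claim fails, since p = 0 is matrix positive and has rank 0, while (2n)^d is at least 1. *)

(* Defs.v *)
From HB Require Import structures.
From mathcomp Require Import all_boot all_order all_algebra.
From mathcomp Require Import reals.
From mathcomp Require Import finmap monalg.

Set Implicit Arguments.
Unset Strict Implicit.
Unset Printing Implicit Defensive.

Import Order.TTheory GRing.Theory Num.Theory.

Local Open Scope ring_scope.

(* The letters X_1, ..., X_{2n}: [lshift n j] stands for X_j and [rshift n j]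
   for X_{j+n} = X_j^*. *)
Definition letter (n : nat) : predArgType := 'I_(n + n).

Definition star_letter (n : nat) (i : letter n) : letter n :=
  match split i with
  | inl j => rshift n j
  | inr j => lshift n j
  end.

(* The multi-index alpha^*, characterized by X^(alpha^* ) = (X^alpha)^*. *)
Definition star_word (n : nat) (w : seq (letter n)) : seq (letter n) :=
  rev (map (@star_letter n) w).

(* R<X, X^*>: the monoid algebra over R of the free monoid on the letters. *)
Notation ncpoly R n := {malg R[{fmonom 'I_(n + n)}]}.

Definition ncmon (R : realType) (n : nat) (w : seq (letter n)) : ncpoly R n :=
  << FMonom w >>.

Definition ncstar (R : realType) (n : nat) (p : ncpoly R n) : ncpoly R n :=
  \sum_(w <- msupp p) p@_w *: ncmon R (star_word w).

Definition ncsym (R : realType) (n : nat) (p : ncpoly R n) : Prop :=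
  ncstar p = p.

Definition eval_letter (R : realType) (n k : nat) (M : 'I_n -> 'M[R]_k)
    (i : letter n) : 'M[R]_k :=
  match split i with
  | inl j => M j
  | inr j => (M j)^T
  end.

Definition nceval (R : realType) (n k : nat) (M : 'I_n -> 'M[R]_k)
    (p : ncpoly R n) : 'M[R]_k :=
  \sum_(w <- msupp p) p@_w *: \big[mulmx/1%:M]_(i <- w) eval_letter M i.

Definition psdmx (R : realType) (k : nat) (A : 'M[R]_k) : Prop :=
  A^T = A /\ forall x : 'cV[R]_k, 0 <= (x^T *m A *m x) 0 0.

Definition matrix_positive (R : realType) (n : nat) (p : ncpoly R n) : Prop :=
  ncsym p /\
  forall (k : nat) (M : 'I_n -> 'M[R]_k), psdmx (nceval M p).

(* The multi-indices of length k, in lexicographic order. *)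
Fixpoint words (n k : nat) : seq (seq (letter n)) :=
  if k is k'.+1 then
    [seq i :: w | i <- enum 'I_(n + n), w <- words n k']
  else [:: [::]].

(* The multi-indices of length at most D, in graded lexicographic order. *)
Definition words_le (n D : nat) : seq (seq (letter n)) :=
  flatten [seq words n k | k <- iota 0 D.+1].

Definition Vcol (R : realType) (n D : nat) :
    'cV[ncpoly R n]_(size (words_le n D)) :=
  \col_i ncmon R (nth [::] (words_le n D) i).

Definition Vrow (R : realType) (n D : nat) :
    'rV[ncpoly R n]_(size (words_le n D)) :=
  \row_i ncmon R (star_word (nth [::] (words_le n D) i)).

Definition gram_rep (R : realType) (n D : nat) (p : ncpoly R n)
    (M : 'M[R]_(size (words_le n D))) : Prop :=
  psdmx M /\
  (Vrow R n D *m map_mx (fun a : R => a%:A) M *m Vcol R n D) 0 0 = p.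

(* [is_rank p r]: r is the minimum defining the rank of p. *)
Definition is_rank (R : realType) (n : nat) (p : ncpoly R n) (r : nat) : Prop :=
  (exists (D : nat) (M : 'M[R]_(size (words_le n D))),
      gram_rep p M /\ \rank M = r) /\
  (forall (D : nat) (M : 'M[R]_(size (words_le n D))),
      gram_rep p M -> (r <= \rank M)%N).

Definition Ssum (R : realType) (n d : nat) : ncpoly R n :=
  \sum_(alpha : d.-tuple 'I_(n + n))
    ncmon R (star_word alpha) * ncmon R alpha.

(* Main.v *)
Require Import Defs.
From mathcomp Require Import all_boot all_order all_algebra.
From mathcomp Require Import reals.
From mathcomp Require Import finmap monalg.
From mathcomp Require Import zify lra.

(* Let q have degree e. Only the coefficients of p in the top degree 2(e + d)
   matter: the Gram matrix is determined there by p, so r is at least the rank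
   of the matrix of the coefficients of p at the words alpha^* beta with
   |alpha| = |beta| = e + d. In top degree, and with q replaced by its leading
   part, symmetry of p says that c = q^* q commutes with S. If 2d <= e this
   forces c = S c' S for a c' with the same properties, and one descends to
   e < 2d. There 0 < e is impossible: c S = S c would make S a product of a
   form of degree e and another one, so that two words of S could be recombined
   into a word not in S. Hence e = 0 (if d > 0), c is a scalar and, undoing the
   descent, p has coefficient k [a = b] at s a^* b t for fixed s, t and k <> 0;
   this is k times the identity matrix of size (2n)^d. *)

Set Implicit Arguments.
Unset Strict Implicit.
Unset Printing Implicit Defensive.

Import GRing.Theory Num.Theory.

Local Open Scope ring_scope.

(** * Words and their adjoints *)

Lemma star_letterK (n : nat) : involutive (@star_letter n).
Proof.
rewrite /star_letter => i; case: (split_ordP i) => j ->.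
  by rewrite (unsplitK (inr j)).
by rewrite (unsplitK (inl j)).
Qed.

Lemma star_wordK (n : nat) : involutive (@star_word n).
Proof.
move=> w; rewrite /star_word map_rev revK -map_comp map_id_in // => i _.
exact: star_letterK.
Qed.

Lemma star_word_cat (n : nat) (u v : seq (letter n)) :
  star_word (u ++ v) = star_word v ++ star_word u.
Proof. by rewrite /star_word map_cat rev_cat. Qed.

Lemma size_star_word (n : nat) (w : seq (letter n)) :
  size (star_word w) = size w.
Proof. by rewrite /star_word size_rev size_map. Qed.

Lemma head_star_word (n : nat) (x : letter n) (w : seq (letter n)) :
  head (star_letter x) (star_word w) = star_letter (last x w).
Proof.
by case/lastP: w => // w y; rewrite /star_word map_rcons rev_rcons last_rcons.
Qed.

(** The adjoint is [star_word b ++ a], and halves of equal length compare separately. In the base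
    case of the descent this test yields the identity matrix. *)
Lemma star_cat_self_adjoint (n : nat) (a b : seq (letter n)) :
  size a = size b ->
  (star_word (star_word a ++ b) == star_word a ++ b) = (a == b).
Proof.
move=> ab; rewrite star_word_cat star_wordK eqseq_cat ?size_star_word //.
by rewrite (can_eq (@star_wordK n)) eq_sym andbb.
Qed.

(** Equal total lengths leave no slack in either inequality. This is what isolates the top-degree
    terms of a product. *)
Lemma eqseq_cat_le (T : eqType) (x y u v : seq T) :
  (size x <= size u)%N -> (size y <= size v)%N ->
  (x ++ y == u ++ v) = (x == u) && (y == v).
Proof.
move=> xu yv; have [sx|sx] := eqVneq (size x) (size u); first exact: eqseq_cat.
have -> : (x == u) = false by apply: contraNF sx => /eqP->.
apply: contraNF sx => /eqP/(congr1 size); rewrite !size_cat; lia.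
Qed.

Lemma split_at_size (T : Type) (a b : nat) (w : seq T) : size w = (a + b)%N ->
  exists u v, [/\ w = u ++ v, size u = a & size v = b].
Proof.
move=> sw; exists (take a w), (drop a w).
by rewrite cat_take_drop size_takel ?size_drop sw ?leq_addr // addKn.
Qed.

(** * Products that commute with the sum of squares *)

(* The words [z] with [star_word z == z] of size [d + d] are those of the form
   [star_word a ++ a]. Thus [S] is, in size [d + d], the coefficient function of
   the sum of squares, and the hypothesis [ABS] says that the product of the
   homogeneous polynomials with coefficients [A] and [B], of degree [e],
   commutes with it. *)
Lemma comm_middle_diagonal (n d : nat) (R : idomainType) (e : nat)
    (A B : seq (letter n) -> R)
    (S := fun z : seq (letter n) => (star_word z == z)%:R : R) :
  (0 < n)%N ->
  (exists2 x, size x = e & A x != 0) ->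
  (exists2 y, size y = e & B y != 0) ->
  (forall x y z x' y' z', size x = e -> size y = e -> size z = (d + d)%N ->
     size x' = e -> size y' = e -> size z' = (d + d)%N ->
     x ++ y ++ z = z' ++ x' ++ y' -> A x * B y * S z = S z' * A x' * B y') ->
  exists s t (k : R), [/\ k != 0, size s = e, size t = e &
    forall x y z a b, size x = e -> size y = e -> size z = (d + d)%N ->
      size a = d -> size b = d ->
      x ++ y ++ z = s ++ star_word a ++ b ++ t ->
      A x * B y * S z = k *+ (a == b)].
Proof.
move=> n0.
have [-> | d0] := posnP d.
  (* The case [d = 0] is kept apart because a descent by [d + d] would not decrease [e]. Here [z],
     [a] and [b] are empty, so [x] and [y] must be [x0] and [y0]. *)
  case=> x0 sx0 Ax0 [y0 sy0 By0] _.
  exists x0, y0, (A x0 * B y0); split=> //; first by rewrite mulf_neq0.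
  move=> x y z a b sx sy /size0nil-> /size0nil-> /size0nil->.
  rewrite cats0 /= => /eqP; rewrite eqseq_cat ?sx // => /andP[/eqP-> /eqP->].
  by rewrite /S eqxx mulr1.
have [e' le_ee'] := ubnP e.
elim: e' => // e' IH in e A B le_ee' *.
case=> x0 sx0 Ax0 [y0 sy0 By0] ABS.
(* As [d > 0], this is a word of [S] with first letter [star_letter i] and last letter [i]. *)
pose pal i : seq (letter n) := nseq d (star_letter i) ++ nseq d i.
have pal_sz i : size (pal i) = (d + d)%N by rewrite size_cat !size_nseq.
have S_pal i : S (pal i) = 1.
  rewrite /S /pal /star_word map_cat rev_cat !map_nseq !rev_nseq star_letterK.
  by rewrite eqxx.
have [e0 | e_gt0] := posnP e.
  rewrite {}e0 in le_ee' sx0 sy0 ABS *.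
  exists [::], [::], (A [::] * B [::]); split=> //.
    by move: Ax0 By0; rewrite (size0nil sx0) (size0nil sy0); exact: mulf_neq0.
  move=> x y z a b /size0nil-> /size0nil-> sz sa sb; rewrite cats0 /= => ->.
  by rewrite /S star_cat_self_adjoint ?sa ?sb // mulr_natr.
have [e_small | e_large] := ltnP e (d + d)%N.
  (* Contradiction for [0 < e < d + d]: cut [pal i] and [pal j] after [e] letters and glue the head
     of the first to the tail of the second. Distinctness of [i] and [j] is what counts. *)
  pose i := lshift n (Ordinal n0); pose j := rshift n (Ordinal n0).
  (* Regroup [pal l ++ x0 ++ y0] as [u ++ y ++ z]. In the nonzero product, [A u] depends only on the
     head of [pal l], and [B y * S z] only on its tail. *)
  have factor l : exists u v y z, [/\ pal l = u ++ v, size u = e,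
      size v = (d + d - e)%N, v ++ x0 ++ y0 = y ++ z & size y = e /\
      size z = (d + d)%N] /\ A u * (B y * S z) != 0.
    have sp : size (pal l) = (e + (d + d - e))%N.
      by rewrite pal_sz subnKC // ltnW.
    have [u [v [def_uv su sv]]] := split_at_size sp.
    have sw : size (v ++ x0 ++ y0) = (e + (d + d))%N.
      by rewrite !size_cat sv sx0 sy0; lia.
    have [y [z [def_yz sy sz]]] := split_at_size sw.
    exists u, v, y, z; split=> //.
    rewrite mulrA (ABS _ _ _ x0 y0 (pal l)) ?def_uv -?catA ?def_yz //.
      by rewrite -def_uv S_pal mul1r mulf_neq0.
    by rewrite -def_uv.
  have [u [v1 [y1 [z1 [[def_u su _ _ _] nz_u]]]]] := factor i.
  have [u' [v [y [z [[def_v su' sv def_yz [sy sz]] nz_v]]]]] := factor j.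
  have: A u * (B y * S z) != 0.
    by move: nz_u nz_v; rewrite !mulf_eq0 !negb_or => /andP[-> _] /andP[_ ->].
  rewrite mulrA (ABS _ _ _ x0 y0 (u ++ v)) //; first last.
  - by rewrite -catA -def_yz.
  - by rewrite size_cat su sv subnKC // ltnW.
  rewrite !mulf_eq0 !negb_or -andbA => /and3P[+ _ _].
  rewrite /S; case: (star_word _ =P _) => [uv_pal _|_]; last by rewrite eqxx.
  (* The self-adjoint word [u ++ v] would begin with [star_letter i] and end with [j], forcing
     [i = j]. *)
  have := head_star_word i (u ++ v); rewrite uv_pal.
  have -> : head (star_letter i) (u ++ v) = star_letter i.
    have := congr1 (head (star_letter i)) def_u.
    by rewrite /pal -(prednK d0) /= => ->; case: (u) su e_gt0 => //= <-.
  rewrite last_cat.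
  have v_gt0 : (0 < size v)%N by rewrite sv subn_gt0.
  have -> : last (last i u) v = j.
    have last_nseq k m : last k (nseq m.+1 j) = j by elim: m k => //= m <-.
    have := congr1 (last i) def_v.
    rewrite /pal !last_cat -(prednK d0) last_nseq => ->.
    by case: (v) v_gt0.
  by move=> /(can_inj (@star_letterK n)) /(congr1 val) /=; lia.
have [z0 sz0 Sz0] : exists2 z0, size z0 = (d + d)%N & S z0 = 1.
  by exists (pal (lshift n (Ordinal n0))).
pose f := (e - (d + d))%N.
have ef : e = (d + d + f)%N by rewrite subnKC.
(* [S] divides [A] on the left: for fixed [v], commutation makes [A (u' ++ v) * B y0] a constant
   times [S u'], and [u' = z0] identifies the constant. [sB] is the mirror image. *)
have sA u v : size u = (d + d)%N -> size v = f ->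
    A (u ++ v) = S u * A (z0 ++ v).
  move=> su sv; apply: (mulIf By0).
  have sw : size (v ++ y0 ++ z0) = (e + e)%N.
    by rewrite !size_cat sv sy0 sz0; lia.
  have [x [y [def_xy sx sy]]] := split_at_size sw.
  have Eu u' : size u' = (d + d)%N -> A (u' ++ v) * B y0 = S u' * (A x * B y).
    move=> su'; rewrite mulrA -(ABS (u' ++ v) y0 z0) ?Sz0 ?mulr1 //.
      by rewrite size_cat su' sv ef.
    by rewrite -catA def_xy.
  by rewrite -mulrA !Eu // Sz0 mul1r.
have sB u v : size u = (d + d)%N -> size v = f ->
    B (v ++ u) = B (v ++ z0) * S u.
  move=> su sv; apply: (mulfI Ax0).
  have sw : size (z0 ++ x0 ++ v) = (e + e)%N.
    by rewrite !size_cat sv sx0 sz0; lia.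
  have [x [y [def_xy sx sy]]] := split_at_size sw.
  have Eu u' : size u' = (d + d)%N -> A x0 * B (v ++ u') = A x * B y * S u'.
    move=> su'; rewrite (ABS x y u' x0 (v ++ u') z0) ?Sz0 ?mul1r //.
      by rewrite size_cat su' sv addnC ef.
    by rewrite [LHS]catA -def_xy -!catA.
  by rewrite mulrA !Eu // Sz0 mulr1.
case: (IH f (fun v => A (z0 ++ v)) (fun v => B (v ++ z0))).
- lia.
- have [u [v [def_x su sv]]] := split_at_size (etrans sx0 ef).
  by exists v => //; move: Ax0; rewrite def_x sA // mulf_eq0 negb_or => /andP[].
- have [v [u [def_y sv su]]] :=
    split_at_size (etrans sy0 (etrans ef (addnC _ _))).
  by exists v => //; move: By0; rewrite def_y sB // mulf_eq0 negb_or => /andP[].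
- move=> x y z x' y' z' sx sy sz sx' sy' sz' E.
  (* Padding with [z0], where [S] is 1, cancels the factors split off and leaves the commutation of
     the quotients with [S]. *)
  have := ABS (z0 ++ x) (y ++ z) z0 (z' ++ x') (y' ++ z0) z0.
  have -> : (z0 ++ x) ++ (y ++ z) ++ z0 = z0 ++ (z' ++ x') ++ y' ++ z0.
    by rewrite -!catA; congr (_ ++ _); rewrite !catA -(catA x) E !catA.
  rewrite !size_cat sx sy sz sx' sy' sz' sz0 -ef [(f + _)%N]addnC -ef.
  move=> /(_ erefl erefl erefl erefl erefl erefl erefl).
  by rewrite sB // (sA z') // Sz0 mulr1 mul1r mulrA.
move=> s [t [k [k0 ss st HP]]].
exists (z0 ++ s), (t ++ z0), k; split=> //.
- by rewrite size_cat sz0 ss ef.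
- by rewrite size_cat sz0 st addnC ef.
move=> x y z a b sx sy sz sa sb E.
have sw : size (s ++ star_word a ++ b ++ t) = (f + (f + (d + d)))%N.
  rewrite !size_cat size_star_word sa sb ss st; lia.
have [x1 [w [def_w sx1 sw1]]] := split_at_size sw.
have [y1 [z1 [def_w1 sy1 sz1]]] := split_at_size sw1.
have szw : size (z0 ++ x1) = e by rewrite size_cat sz0 sx1 -ef.
have szw1 : size (y1 ++ z1) = e by rewrite size_cat sy1 sz1 addnC -ef.
(* The outer copies of [z0] absorb the factors split off, so the value is that of the quotients at
   [x1], [y1], [z1]. *)
have : x ++ y ++ z == (z0 ++ x1) ++ (y1 ++ z1) ++ z0.
  apply/eqP; rewrite E -!catA [y1 ++ _]catA -def_w1 [x1 ++ _]catA -def_w.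
  by rewrite -!catA.
rewrite !eqseq_cat ?szw ?szw1 // => /and3P[/eqP-> /eqP-> /eqP->].
by rewrite sB // Sz0 mulr1 mulrA (HP x1 y1 z1 a b) // -def_w1 -def_w.
Qed.

(** * Coefficients and degrees of noncommutative polynomials *)

Lemma mcoeff_sum_supp (K : choiceType) (R : nzRingType) (g : {malg R[K]})
    (k : K) :
  g@_k = \sum_(k' <- msupp g) g@_k' * (k' == k)%:R.
Proof.
rewrite {1}[g]monalgE raddf_sum; apply: eq_bigr => k' _.
by rewrite /= mcoeffU mulr_natr.
Qed.

Lemma mcoeff_ncstar (R : realType) (n : nat) (p : ncpoly R n)
    (w : seq (letter n)) :
  (ncstar p)@_(FMonom w) = p@_(FMonom (star_word w)).
Proof.
rewrite [RHS]mcoeff_sum_supp raddf_sum; apply: eq_bigr => -[u] _ /=.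
rewrite mcoeffZ mcoeffU1; congr (_ * (nat_of_bool _)%:R).
by rewrite -!val_eqE /= (can2_eq (@star_wordK n) (@star_wordK n)).
Qed.

Lemma ncmonM (R : realType) (n : nat) (u v : seq (letter n)) :
  ncmon R u * ncmon R v = ncmon R (u ++ v).
Proof.
apply/malgP => k; rewrite malgM_def fgmulUU mulr1 !mcoeffU1.
by congr (nat_of_bool (_ == k))%:R; apply/val_inj; rewrite /= fmM.
Qed.

(** An upper bound rather than a degree, so that it passes to products and adjoints without
    nonvanishing conditions. *)
Definition ncdeg_le (R : realType) (n m : nat) (f : ncpoly R n) : Prop :=
  forall w : seq (letter n), (m < size w)%N -> f@_(FMonom w) = 0.

Lemma ncdeg_le_supp (R : realType) (n m : nat) (f : ncpoly R n)
    (w : seq (letter n)) :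
  ncdeg_le m f -> FMonom w \in msupp f -> (size w <= m)%N.
Proof.
by move=> fm; rewrite -mcoeff_neq0; apply: contraNleq => /fm->.
Qed.

(** Under the degree bounds, [u ++ v] arises from the pair [u], [v] only, so the convolution has a
    single term. *)
Lemma mcoeffM_top (R : realType) (n : nat) (f g : ncpoly R n) (a b : nat)
    (u v : seq (letter n)) :
  ncdeg_le a f -> ncdeg_le b g -> size u = a -> size v = b ->
  (f * g)@_(FMonom (u ++ v)) = f@_(FMonom u) * g@_(FMonom v).
Proof.
move=> fa gb su sv; rewrite mcoeffMl.
rewrite [f@_(FMonom u)]mcoeff_sum_supp [g@_(FMonom v)]mcoeff_sum_supp.
rewrite mulr_suml big_seq [RHS]big_seq; apply: eq_bigr => -[x] fx.
rewrite mulr_sumr big_seq [RHS]big_seq; apply: eq_bigr => -[y] gy.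
rewrite -!val_eqE /= fmM /= mulrACA -natrM mulnb mulr_natr.
move/(ncdeg_le_supp fa): fx; move/(ncdeg_le_supp gb): gy.
by rewrite -sv -su => yv xu; rewrite eqseq_cat_le.
Qed.

Lemma ncdeg_leM (R : realType) (n : nat) (f g : ncpoly R n) (a b : nat) :
  ncdeg_le a f -> ncdeg_le b g -> ncdeg_le (a + b) (f * g).
Proof.
move=> fa gb w sw; rewrite mcoeffMl big_seq big1 // => -[x] fx.
rewrite big_seq big1 // => -[y] gy.
rewrite -val_eqE /= fmM; case: eqP => // E.
have := leq_add (ncdeg_le_supp fa fx) (ncdeg_le_supp gb gy).
by rewrite -size_cat /= E leqNgt sw.
Qed.

Lemma ncdeg_le_star (R : realType) (n : nat) (f : ncpoly R n) (a : nat) :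
  ncdeg_le a f -> ncdeg_le a (ncstar f).
Proof. by move=> fa w sw; rewrite mcoeff_ncstar fa ?size_star_word. Qed.

Lemma ncdeg_exists (R : realType) (n : nat) (f : ncpoly R n) :
  f != 0 ->
  exists e, ncdeg_le e f /\ exists2 w, size w = e & f@_(FMonom w) != 0.
Proof.
move=> f0; pose P m := has (fun w : {fmonom letter n} => size w == m) (msupp f).
have [w0 w0f] : exists w, w \in msupp f.
  have [E|[w ?]] := fset_0Vmem (msupp f); last by exists w.
  by move: f0; rewrite -msupp_eq0 E eqxx.
have exP : exists m, P m by exists (size w0); apply/hasP; exists w0.
have ubP m : P m -> (m <= \max_(w <- msupp f) size (w : {fmonom letter n}))%N.
  by case/hasP=> w wf /eqP <-; exact: leq_bigmax_seq.
case: (ex_maxnP exP ubP) => e /hasP[[w] wf /eqP swe] max_e.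
exists e; split; last by exists w => //; rewrite mcoeff_neq0.
move=> u; apply: contraTeq; rewrite mcoeff_neq0 -leqNgt => uf.
by apply: max_e; apply/hasP; exists (FMonom u).
Qed.

(** A self-adjoint word of length [d + d] determines its summand: the index is its right half. *)
Lemma mcoeff_Ssum (R : realType) (n d : nat) (w : seq (letter n)) :
  (Ssum R n d)@_(FMonom w) =
  ((size w == (d + d)%N) && (star_word w == w))%:R.
Proof.
rewrite /Ssum raddf_sum.
under eq_bigr => a _ do rewrite ncmonM /= mcoeffU1 -val_eqE /=.
have [/andP[/eqP sw /eqP pal_w] | nw] := boolP (_ && _).
  have [u [a [def_w su sa]]] := split_at_size sw.
  have {su} def_u : u = star_word a.
    move/eqP: pal_w; rewrite def_w star_word_cat.
    rewrite eqseq_cat ?size_star_word ?sa //.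
    by case/andP => /eqP.
  rewrite (bigD1 (Tuple (introT eqP sa))) //= def_w def_u eqxx big1 ?addr0 //.
  move=> b; rewrite -val_eqE eqseq_cat ?size_star_word ?size_tuple //=.
  by move/negPf->; rewrite andbF.
rewrite big1 // => a _; case: eqP => // def_w; case/negP: nw.
by rewrite -def_w size_cat size_star_word size_tuple star_cat_self_adjoint ?eqxx.
Qed.

(** * Gram matrices and their top-degree entries *)

Lemma size_words (n k : nat) (w : seq (letter n)) :
  w \in words n k -> size w = k.
Proof.
elim: k w => [|k IH] w /=; first by rewrite inE => /eqP->.
by case/allpairsP => -[i u] [_ /= /IH <- ->].
Qed.

Lemma uniq_words (n k : nat) : uniq (words n k).
Proof.
elim: k => //= k IH; apply: allpairs_uniq => //; first exact: enum_uniq.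
by move=> [i u] [j v] _ _ [-> ->].
Qed.

Lemma uniq_words_le (n D : nat) : uniq (words_le n D).
Proof.
rewrite /words_le; elim: D.+1 {1}0%N => //= k IH m.
rewrite cat_uniq uniq_words IH andbT /=; apply/hasPn => w.
case/flattenP => _ /mapP[l + ->] /size_words sw.
rewrite mem_iota => /andP[ml _]; apply/negP => /size_words; lia.
Qed.

(** With [A i i = 0] the quadratic form at t e_i + e_j is affine in t, and an affine function
    bounded below has slope 0. *)
Lemma psdmx_diag0 (R : realType) (k : nat) (A : 'M[R]_k) (i j : 'I_k) :
  psdmx A -> A i i = 0 -> A i j = 0.
Proof.
move=> [sA pA] Aii.
have Aji : A j i = A i j by rewrite -[in RHS]sA mxE.
have form t : 0 <= t * A i j *+ 2 + A j j.
  have := pA (t *: delta_mx i 0 + delta_mx j 0).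
  rewrite [(_ + _)^T]linearD /= linearZ /= !mulmxDl !mulmxDr.
  rewrite -!scalemxAl -!scalemxAr !trmx_delta -!rowE -!colE !mxE Aii Aji.
  by rewrite mulr0 mulr0 add0r addrA -mulr2n.
apply/eqP; apply: contraT => nz.
(* This value of t makes the form equal to -1. *)
have := form (- (A j j + 1) / (A i j *+ 2)).
rewrite -mulrnAr mulfVK ?mulrn_eq0 //; lra.
Qed.

Lemma mcoeff_gram (R : realType) (n D : nat) (p : ncpoly R n)
    (M : 'M[R]_(size (words_le n D))) (w : seq (letter n))
    (W := nth [::] (words_le n D)) :
  gram_rep p M ->
  p@_(FMonom w) =
    \sum_(i < _) \sum_(j < _) M i j * (star_word (W i) ++ W j == w)%:R.
Proof.
case=> _ <-; rewrite mxE raddf_sum exchange_big; apply: eq_bigr => j _ /=.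
rewrite !mxE mulr_suml raddf_sum; apply: eq_bigr => i _ /=.
rewrite !mxE -mul_malgC mulr1 !malgM_def !fgmulUU mcoeffU mulr1 mul1r mulm1.
by rewrite -val_eqE /= fmM mulr_natr.
Qed.

(** For words of length at most [m], only [W i = u] and [W j = v] can produce [star_word u ++ v].
    The indicators spare locating [u] and [v] in the list, and present the sum as an entry of a
    product of three matrices. *)
Lemma mcoeff_gram_top (R : realType) (n D m : nat) (p : ncpoly R n)
    (M : 'M[R]_(size (words_le n D))) (u v : seq (letter n))
    (W := nth [::] (words_le n D)) :
  gram_rep p M -> (forall i j : 'I__, M i j != 0 -> (size (W i) <= m)%N) ->
  size u = m -> size v = m ->
  p@_(FMonom (star_word u ++ v)) =
    \sum_(i < _) \sum_(j < _) (W i == u)%:R * M i j * (W j == v)%:R.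
Proof.
move=> gM sM su sv; rewrite (mcoeff_gram _ gM).
have symM k l : M k l = M l k by case: gM => -[tM _] _; rewrite -[in RHS]tM mxE.
apply: eq_bigr => i _; apply: eq_bigr => j _.
have [->|nz] := eqVneq (M i j) 0; first by rewrite mulr0 !mul0r.
have := sM _ _ nz; rewrite symM in nz; have := sM _ _ nz.
rewrite [RHS]mulrAC [RHS]mulrC -natrM mulnb -/W => sj si.
rewrite eqseq_cat_le ?size_star_word ?su ?sv //.
congr (_ * (nat_of_bool (_ && _))%:R).
by apply/eqP/eqP => [/(can_inj (@star_wordK n))|->].
Qed.

(** A nonzero entry gives a nonzero diagonal entry. Take a longest [W l] with [M l l != 0]: were it
    longer than [m], the coefficient of [p] at [star_word (W l) ++ W l] would be [M l l], yet it
    vanishes by degree. *)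
Lemma gram_size_le (R : realType) (n D m : nat) (p : ncpoly R n)
    (M : 'M[R]_(size (words_le n D))) (i j : 'I_(size (words_le n D)))
    (W := nth [::] (words_le n D)) :
  gram_rep p M -> ncdeg_le (m + m) p -> M i j != 0 -> (size (W i) <= m)%N.
Proof.
move=> gM pm nz.
have diag k l : M k l != 0 -> M k k != 0.
  by apply: contra_neq; apply: psdmx_diag0; case: gM.
have {j nz} ii := diag _ _ nz.
case: (arg_maxnP (P := fun l => M l l != 0) (fun l => size (W l)) ii)
  => l ll max_l.
apply: leq_trans (max_l i ii) _; rewrite leqNgt; apply/negP => ml.
case/negP: ll.
have sM k k' : M k k' != 0 -> (size (W k) <= size (W l))%N.
  by move/diag; exact: max_l.
have := mcoeff_gram_top gM sM erefl erefl.
rewrite pm ?size_cat ?size_star_word; last by lia.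
have W_inj (k : 'I_(size (words_le n D))) : (W k == W l) = (k == l).
  exact: (nth_uniq [::] (ltn_ord k) (ltn_ord l) (uniq_words_le n D)).
rewrite (bigD1 (l : 'I_(size (words_le n D)))) //.
rewrite [X in _ = X + _](bigD1 (l : 'I_(size (words_le n D)))) //.
rewrite -/W eqxx mulr1 mul1r !big1 ?addr0.
- by rewrite /= addr0 => /esym/eqP.
- by move=> k kl; rewrite big1 // => k' _; rewrite W_inj (negPf kl) !mul0r.
- by move=> k kl; rewrite W_inj (negPf kl) mulr0.
Qed.

(** * The rank bound *)

Lemma mulmx3_rank_scalar (F : fieldType) (N k : nat) (L : 'M[F]_(N, k))
    (M : 'M[F]_k) (R : 'M[F]_(k, N)) (c : F) :
  c != 0 -> L *m M *m R = c%:M -> (N <= \rank M)%N.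
Proof.
move=> c0 LMR; apply: leq_trans (mxrankM_maxr L M).
apply: leq_trans (mxrankM_maxl (L *m M) R).
by rewrite LMR -scalemx1 mxrank_scale_nz // mxrank1.
Qed.

Theorem theorem3p4 (R : realType) (n d : nat) (p q : ncpoly R n) (r : nat) :
  (0 < n)%N ->
  p != 0 ->
  matrix_positive p ->
  p = ncstar q * q * Ssum R n d ->
  is_rank p r ->
  ((2 * n) ^ d <= r)%N.
Proof.
move=> n0 p0 [p_sym _] def_p [[D [M [gM <-]]] _].
have q0 : q != 0 by apply: contra_neq p0 => q0; rewrite def_p q0 mulr0 mul0r.
have [e [qe [y0 sy0 qy0]]] := ncdeg_exists q0.
(* The coefficients of [ncstar q] and of [q]. *)
pose A x := q@_(FMonom (star_word x)); pose B y := q@_(FMonom y).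
have Sd : ncdeg_le (d + d) (Ssum R n d).
  by move=> w sw; rewrite mcoeff_Ssum gtn_eqF.
have qqe := ncdeg_leM (ncdeg_le_star qe) qe.
have pe : ncdeg_le (e + d + (e + d)) p.
  by rewrite addnACA def_p; exact: ncdeg_leM.
have p_top x y z : size x = e -> size y = e -> size z = (d + d)%N ->
    p@_(FMonom (x ++ y ++ z)) = A x * B y * (star_word z == z)%:R.
  move=> sx sy sz; rewrite def_p catA.
  rewrite (mcoeffM_top qqe Sd) ?size_cat ?sx ?sy //.
  rewrite (mcoeffM_top (ncdeg_le_star qe) qe) //.
  by rewrite mcoeff_ncstar mcoeff_Ssum sz eqxx.
have [||| s [t [k [k0 ss st diag]]]] :=
    @comm_middle_diagonal n d R e A B n0.
- by exists (star_word y0); rewrite ?size_star_word // /A star_wordK.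
- by exists y0.
- move=> x y z x' y' z' sx sy sz sx' sy' sz' E.
  (* Symmetry of [p] reads the coefficient at the adjoint word, which reverses the three factors;
     [A] and [B] are exchanged by [star_word]. *)
  rewrite -p_top // E -p_sym mcoeff_ncstar !star_word_cat -catA.
  rewrite p_top ?size_star_word // star_wordK (eq_sym z') /A /B star_wordK.
  by rewrite mulrC [B _ * _]mulrC mulrA.
pose N := #|{: d.-tuple 'I_(n + n)}|.
have -> : ((2 * n) ^ d)%N = N by rewrite /N card_tuple card_ord mul2n addnn.
pose W := nth [::] (words_le n D).
(* Chosen so that [star_word (u a) ++ v b] is s a^* b t, the shape of word in [diag]. *)
pose u (a : 'I_N) : seq (letter n) := enum_val a ++ star_word s.
pose v (b : 'I_N) : seq (letter n) := enum_val b ++ t.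
have su a : size (u a) = (e + d)%N.
  by rewrite size_cat size_tuple size_star_word ss addnC.
have sv b : size (v b) = (e + d)%N.
  by rewrite size_cat size_tuple st addnC.
have sM (i j : 'I_(size (words_le n D))) :
    M i j != 0 -> (size (W i) <= e + d)%N.
  exact: (gram_size_le gM pe).
apply: (@mulmx3_rank_scalar _ _ _ (\matrix_(a, i) (W i == u a)%:R) _
  (\matrix_(j, b) (W j == v b)%:R) k k0).
apply/matrixP => a b; rewrite !mxE.
transitivity (p@_(FMonom (star_word (u a) ++ v b))).
  rewrite (mcoeff_gram_top gM sM) // exchange_big.
  apply: eq_bigr => j _; rewrite !mxE mulr_suml.
  by apply: eq_bigr => i _; rewrite !mxE.
have sw : size (star_word (u a) ++ v b) = (e + (e + (d + d)))%N.
  rewrite size_cat size_star_word su sv; lia.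
have [x [w [def_w sx sw1]]] := split_at_size sw.
have [y [z [def_w1 sy sz]]] := split_at_size sw1.
rewrite def_w def_w1 p_top //.
rewrite (diag _ _ _ (enum_val a) (enum_val b)) ?size_tuple //.
  by rewrite val_eqE (inj_eq enum_val_inj).
by rewrite -def_w1 -def_w star_word_cat star_wordK -catA.
Qed.
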